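(* Let $\mu,p,a,b,\gamma,\eta$ be as in the context, let $J\supseteq(a,b)$ be an interval on which both functions $\eta$ and $\gamma$ are defined, and let $W,W'$ be identically distributed real-valued random variables on a common probability space with values only in $J$. Assume that $W$ is square integrable with $E[|\gamma(W)|]<\infty$, and that the pair $(W,W')$ satisfies the regression property $$E[W'-W\mid W]=\lambda\gamma(W)+R$$ for some constant $\lambda>0$ and some (remainder) random variable $R$. Let $f:J\to\mathbb{R}$ be an absolutely continuous function with $\|f\|_\infty,\|f'\|_\infty<\infty$, where $f'$ is a given Borel-measurable version of the derivative of $f$. Then $$\bigl|E[\eta(W)f'(W)+\gamma(W)f(W)]\bigr|\le\|f'\|_\infty E\Bigl[\Bigl|\eta(W)-\tfrac1{2\lambda}E[(W'-W)^2\mid W]\Bigr|\Bigr]$$ $$+\tfrac1\lambda E\Bigl[(W'-W)^2\int_0^1(1-s)\bigl|f'(W)-f'(W+s(W'-W))\bigr|ds\Bigr]+\frac{\|f\|_\infty}{\lambda}E[|R|].$$ If $f'$ is also absolutely continuous and $\|f''\|_\infty<\infty$ for some Borel-measurable version $f''$ of the second derivative, then also $$\bigl|E[\eta(W)f'(W)+\gamma(W)f(W)]\bigr|\le\|f'\|_\infty E\Bigl[\Bigl|\eta(W)-\tfrac1{2\lambda}E[(W'-W)^2\mid W]\Bigr|\Bigr]+\frac{\|f''\|_\infty}{6\lambda}E\bigl[|W'-W|^3\bigr]+\frac{\|f\|_\infty}{\lambda}E[|R|].$$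
   Context: Let $-\infty\le a<b\le\infty$ and let $\mu$ be an absolutely continuous probability distribution on $\mathbb{R}$ with density $p$, supported in $\overline{(a,b)}$ (closure in $\mathbb{R}$), where $a$ (if finite) and $b$ (if finite) are the left and right endpoints of the support. The density $p$ is positive on $(a,b)$ and absolutely continuous on every compact subinterval of $(a,b)$. The function $\gamma$ is continuous and strictly decreasing on $\overline{(a,b)}$, with $\int_a^b|\gamma(t)|p(t)dt<\infty$ and $\int_a^b\gamma(t)p(t)dt=0$, and it has a unique zero $x_0\in\overline{(a,b)}$. On $(a,b)$ the function $\eta$ is given by $\eta(x):=\frac1{p(x)}\int_a^x\gamma(t)p(t)dt$. If $J$ is larger than $(a,b)$, $\gamma$ and $\eta$ are supposed to be extended to functions on $J$. For a function on $J$, $\|\cdot\|_\infty$ denotes its essential supremum norm.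
   Formalization: The first bound is proved under the added assumption that |f'(W)| ≤ ‖f'‖∞ almost surely; without it the bound fails for versions f' that exceed their essential supremum on a Lebesgue-null set charged by W (e.g. W=W'=0, f=0, f'=1 at 0 only). *)

(* Defs.v *)
From HB Require Import structures.
From mathcomp Require Export all_boot all_order all_algebra.
From mathcomp Require Export all_classical all_reals all_analysis.

Set Implicit Arguments.
Unset Strict Implicit.
Unset Printing Implicit Defensive.

Import Order.TTheory GRing.Theory Num.Theory.
Import numFieldNormedType.Exports.

Local Open Scope classical_set_scope.
Local Open Scope ring_scope.

(* Functions on a subset A of the line are represented by total functions
   R -> R of which only the values on A matter. *)

Definition open_itv (R : realType) (a b : \bar R) : set R :=
  [set x | (a < x%:E)%E /\ (x%:E < b)%E].

(* The pairwise disjoint intervals may be degenerate (u i = v i); such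
   intervals contribute 0 to both sums. *)
Definition abs_continuous_on (R : realType) (A : set R) (g : R -> R) : Prop :=
  forall e : R, 0 < e -> exists2 d : R, 0 < d &
    forall (n : nat) (u v : 'I_n -> R),
      (forall i, u i <= v i /\ `[u i, v i] `<=` A) ->
      trivIset [set: 'I_n] (fun i => `]u i, v i[%classic) ->
      \sum_(i < n) (v i - u i) < d ->
      \sum_(i < n) `|g (v i) - g (u i)| < e.

(* Only used on intervals J.  Two-sided derivatives are taken in the interior
   of J, which differs from J by at most two points. *)
Definition derivative_version (R : realType) (J : set R) (g g' : R -> R) : Prop :=
  measurable_fun J g' /\
  \forall x \ae (@lebesgue_measure R), (J^°)%classic x -> is_derive x (1 : R) g (g' x).

(* Essential supremum of |g| over J for the Lebesgue measure: restricting |g|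
   to J by 0 is harmless because |g| >= 0. *)
Definition sup_norm (R : realType) (J : set R) (g : R -> R) : \bar R :=
  'N[@lebesgue_measure R]_+oo [EFin \o (g \_ J)].

(* Z is a version of E[Y | X]; meaningful for P-integrable Y. *)
Definition cond_expectation_version d (T : measurableType d) (R : realType)
    (P : probability T R) (X Y Z : T -> R) : Prop :=
  [/\ P.-integrable [set: T] (EFin \o Z),
      preimage_set_system [set: T] Z measurable `<=`
        preimage_set_system [set: T] X measurable &
      forall A, preimage_set_system [set: T] X measurable A ->
        (\int[P]_(w in A) (Z w)%:E = \int[P]_(w in A) (Y w)%:E)%E].

(* Main.v *)
Require Import Defs.
From mathcomp Require Import measurable_realfun ess_sup_inf ring lra.

(** Let F be a primitive of f on J.  Because W and W' have the same law,
    E[F(W') - F(W)] = 0, and Taylor's formula gives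

      F(W') - F(W) = f(W) (W' - W) + (W' - W)^2 f'(W) / 2 + X,

    where X is the remainder.  Taking expectations, conditioning on W and using
    E[W' - W | W] = lambda gamma(W) + Rem turns this into

      E[eta(W) f'(W) + gamma(W) f(W)]
        = E[(eta(W) - E[(W' - W)^2 | W] / (2 lambda)) f'(W)]
          - E[f(W) Rem] / lambda - E[X] / lambda,

    and the three terms on the right are bounded separately.  This is
    [identically_distributed_pair_bound]; that f(W) and f'(W) can be taken out
    of the conditional expectations is [cond_expectation_bounded].

    The remainder satisfies

      |X| <= (W' - W)^2 * int_0^1 (1 - s) |f'(W) - f'(W + s (W' - W))| ds,

    which is [taylor2_le], and is the second term of the first bound.  If f' is
    absolutely continuous with derivative f'', then f' is Lipschitz with constant
    ||f''||_oo, the integral is at most ||f''||_oo |W' - W| / 6, and the second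
    bound follows.

    The analytic difficulty is that f has a derivative only almost everywhere.
    The argument rests on a mean value inequality for absolutely continuous
    functions, [abs_continuous_le]: it shows that f is Lipschitz, because f' is
    essentially bounded, and, applied to a function minus the primitive of its
    derivative, it gives the fundamental theorem of calculus in the form
    [lipschitz_le_integral], from which Taylor's formula is derived along the
    segment from W to W'.

    Essential suprema control f and f' only up to null sets, which the law of W
    may charge.  For continuous functions they bound every value
    ([abs_continuous_le_sup_norm]), which settles f, and f' in the second bound;
    in the first bound the hypothesis on f'(W) takes this role. *)

Set Implicit Arguments.
Unset Strict Implicit.
Unset Printing Implicit Defensive.

Import Order.TTheory GRing.Theory Num.Theory.
Import numFieldNormedType.Exports.

Local Open Scope classical_set_scope.
Local Open Scope ring_scope.
Import HBNNSimple.

(** * A mean value inequality for absolutely continuous functions *)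

(** Cousin's lemma in the form of an induction: the hypothesis is a gauge around
    each point s, and t, t' range over the pairs that straddle s inside it.  The
    supremum of the points reachable from u is itself such an s, so it can be
    crossed unless it equals v. *)
Lemma interval_induction (R : realType) (P : R -> Prop) (u v : R) :
  u <= v -> P u ->
  (forall s, u <= s <= v -> exists2 r : R, 0 < r &
    forall t t', u <= t <= s -> s <= t' <= v -> s - r < t -> t' < s + r ->
      P t -> P t') ->
  P v.
Proof.
move=> uv Pu step.
pose S : set R := [set t | u <= t <= v /\ P t].
have Su : S u by split; rewrite ?lexx.
have Sub : ubound S v by move=> t [/andP[]].
have supS : has_sup S by split; [exists u | exists v].
have us : u <= sup S by apply: ub_le_sup Su; exists v.
have sv : sup S <= v by apply: ge_sup => //; exists u.
have [|r r0 stepr] := step (sup S); first by rewrite us.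
have [t St st] := sup_adherent r0 supS.
have [/andP[ut tv] Pt] := St.
have ts : t <= sup S by apply: ub_le_sup => //; exists v.
pose t' := Num.min v (sup S + r / 2).
have t'v : t' <= v by rewrite /t' ge_min lexx.
have st' : sup S <= t' by rewrite /t' le_min sv lerDl divr_ge0// ltW.
have t'r : t' < sup S + r by rewrite /t' gt_min; apply/orP; right; lra.
have Pt' : P t' by apply: (stepr t) => //; rewrite ?ut ?ts ?st'.
have St' : S t' by split => //; rewrite t'v (le_trans us).
have : t' <= sup S by apply: ub_le_sup => //; exists v.
rewrite /t' ge_min => /orP[vs|]; last by lra.
by move: Pt'; rewrite /t'; rewrite min_l//; lra.
Qed.

Lemma abs_continuous_onS (R : realType) (A B : set R) (g : R -> R) :
  A `<=` B -> abs_continuous_on B g -> abs_continuous_on A g.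
Proof.
move=> AB gB e /gB[d d0 dP]; exists d => // n u v uvA; apply: dP => i.
by have [? uvAi] := uvA i; split => //; exact: subset_trans AB.
Qed.

Lemma lipschitz_abs_continuous_on (R : realType) (A : set R) (g : R -> R) (K : R) :
  (forall x y, A x -> A y -> `|g x - g y| <= K * `|x - y|) ->
  abs_continuous_on A g.
Proof.
move=> gK e e0; have K1 : 0 < `|K| + 1 by rewrite ltr_wpDl.
exists (e / (`|K| + 1)); first by rewrite divr_gt0.
move=> n u v uvA _; rewrite ltr_pdivlMr// => suv.
apply: le_lt_trans suv; rewrite mulr_suml; apply: ler_sum => i _.
have [uvi Ai] := uvA i.
have /gK : A (v i) by apply: Ai; rewrite /= in_itv/= uvi lexx.
move/(_ (u i)) => /(_ _)/le_trans; apply.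
  by apply: Ai; rewrite /= in_itv/= uvi lexx.
rewrite ger0_norm ?subr_ge0// mulrC ler_wpM2l ?subr_ge0//.
by rewrite (le_trans (ler_norm _))// lerDl.
Qed.

(** Links the total length that enters the definition of absolute continuity
    with the measure of an open set that contains the intervals. *)
Lemma sum_itv_le_measure (R : realType) (U : set R) n (c d : 'I_n -> R) :
  measurable U ->
  (forall i, c i <= d i /\ `[c i, d i] `<=` U) ->
  trivIset [set: 'I_n] (fun i => `]c i, d i[%classic) ->
  ((\sum_(i < n) (d i - c i))%:E <= lebesgue_measure U)%E.
Proof.
move=> mU cdU tcd.
have -> : (\sum_(i < n) (d i - c i))%:E =
    (\sum_(i < n) lebesgue_measure (`]c i, d i[%classic : set R))%E.
  rewrite -sumEFin; apply: eq_bigr => i _.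
  rewrite lebesgue_measure_itv/= lte_fin.
  have [cdi _] := cdU i; case: ltP => [|dc]; first by rewrite EFinB.
  by have -> : c i = d i; [apply/eqP; rewrite eq_le cdi | rewrite subrr].
rewrite -measure_bigsetU_ord//; apply: le_measure; rewrite ?inE//.
  by apply: bigsetU_measurable.
elim/big_ind: _ => //; first by move=> A B AU BU x [/AU|/BU].
move=> i _ x xi; have [_] := cdU i; apply.
exact: subset_itv_oo_cc xi.
Qed.

(** Mean value inequality when the derivative exists only almost everywhere.
    Put the exceptional set N in an open set U of measure less than d, where d
    answers e / 2 in the definition of absolute continuity.  Going from u to v
    by [interval_induction], a point outside N is crossed with slope at most
    M + e1, and a point of N inside an interval contained in U.  The intervals
    of the second kind have total length less than d, so the increments of h
    over them add up to less than e / 2. *)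
Lemma abs_continuous_le (R : realType) (h h' : R -> R) (u v M : R) :
  u <= v -> 0 <= M -> abs_continuous_on `[u, v] h ->
  (\forall x \ae (@lebesgue_measure R), u < x < v ->
     is_derive x (1 : R) h (h' x) /\ `|h' x| <= M) ->
  `|h v - h u| <= M * (v - u).
Proof.
move=> uv M0 hac [N [mN N0 Nh]].
apply/ler_addgt0Pr => e e0.
(* e1 * (v - u) <= e / 2; the term + 1 covers the case u = v *)
pose e1 := e / 2 / (v - u + 1).
have vu1 : 0 < v - u + 1 by rewrite ltr_wpDl ?subr_ge0.
have e10 : 0 < e1 by rewrite !divr_gt0.
have e20 : 0 < e / 2 by rewrite divr_gt0.
have [d d0 dP] := hac _ e20.
(* the derivative is only given inside the interval, so the endpoints join N *)
pose N' : set R := N `|` [set u; v].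
have mN' : measurable N' by apply: measurableU => //; exact: measurableU.
have N'0 : (lebesgue_measure N' = 0)%E.
  rewrite measureU0//; first exact: measurableU.
  by rewrite measureU0//; exact: lebesgue_measure_set1.
have N'y : (lebesgue_measure N' < +oo)%E by rewrite N'0.
have [U [oU N'U UN']] := lebesgue_regularity_outer mN' N'y d0.
have mU : measurable U by exact: open_measurable.
have Ud : (lebesgue_measure U < d%:E)%E.
  have UN0 : (lebesgue_measure (U `&` N') = 0)%E.
    apply/eqP; rewrite -measure_le0 -N'0; apply: le_measure; rewrite ?inE//.
    exact: measurableI.
  by rewrite (measureDI lebesgue_measure mU mN') [X in (_ + X)%E]UN0 adde0.
(* the increment of h from u to t is paid by slope and by intervals inside U *)
pose P t := exists n (c d : 'I_n -> R),
  [/\ forall i, (u <= c i /\ d i <= t) /\ (c i <= d i /\ `[c i, d i] `<=` U),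
   trivIset [set: 'I_n] (fun i => `]c i, d i[%classic) &
   `|h t - h u| <= (M + e1) * (t - u) + \sum_(i < n) `|h (d i) - h (c i)|].
suff [n [c [d' [cd tcd hvu]]]] : P v.
  have : \sum_(i < n) `|h (d' i) - h (c i)| < e / 2.
    apply: dP => //.
      move=> i; have [[ui iv] [cdi _]] := cd i; split => // x.
      by rewrite /= !in_itv/= => /andP[cx xd]; rewrite (le_trans ui)// (le_trans xd).
    rewrite -lte_fin; apply: le_lt_trans Ud; apply: sum_itv_le_measure => // i.
    by have [] := cd i.
  move=> he; have : e1 * (v - u) <= e / 2.
    by rewrite /e1 mulrAC ler_pdivrMr// ler_wpM2l ?(ltW e20)// lerDl.
  by move: hvu; rewrite mulrDl => hvu e1e; lra.
apply: (@interval_induction _ P u v) => //.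
  exists 0%N, (fun=> 0), (fun=> 0); split; first by case.
    by case.
  by rewrite big_ord0 !subrr normr0 mulr0 addr0.
move=> s /andP[us sv].
(* an exceptional s lies in U: add the interval [t, t'] to the family *)
have [N's|nN's] := pselect (N' s).
  have /nbhs_ballP[r /= r0 rU] : nbhs s U by apply: open_nbhs_nbhs; split => //; exact: N'U.
  exists r => // t t' /andP[ut ts] /andP[st' t'v] srt t'sr [n [c [d' [cd tcd hvu]]]].
  exists n.+1, (fun i => oapp c t (unlift ord0 i)), (fun i => oapp d' t' (unlift ord0 i)).
  split.
  - move=> i; case: unliftP => [j _|_] /=.
      have [[H1 H2] H3] := cd j; split => //; split => //.
      by rewrite (le_trans H2)// (le_trans ts).
    split; first by split.
    split; first exact: le_trans st'.
    move=> x; rewrite /= in_itv/= => /andP[tx xt']; apply: rU.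
    by rewrite /ball/= ltr_distlC; apply/andP; split; lra.
  - apply/trivIsetP => i j _ _.
    case: unliftP => [i' ->|->]; case: unliftP => [j' ->|->] //=.
    + rewrite (inj_eq (@lift_inj _ _)) => ij.
      by move/trivIsetP : tcd; apply.
    + move=> _; rewrite -subset0 => x []; rewrite /= !in_itv/= => /andP[_ xd] /andP[tx _].
      by have [[_ di] _] := cd i'; lra.
    + move=> _; rewrite -subset0 => x []; rewrite /= !in_itv/= => /andP[tx _] /andP[_ xd].
      by have [[_ di] _] := cd j'; lra.
  - rewrite big_ord_recl unlift_none/=.
    under eq_bigr do rewrite liftK/=.
    have -> : h t' - h u = (h t - h u) + (h t' - h t) by ring.
    rewrite (le_trans (ler_normD _ _))//.
    have : (M + e1) * (t - u) <= (M + e1) * (t' - u).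
      by rewrite ler_wpM2l ?addr_ge0// ?(ltW e10)// lerD2r (le_trans ts).
    lra.
(* at any other s the difference quotient is within e1 of h' s *)
have [us' sv'] : u < s /\ s < v.
  by split; rewrite lt_neqAle ?us ?sv andbT; apply/eqP => E; apply: nN's; right; rewrite E; [left|right].
have [ds hs] : is_derive s (1 : R) h (h' s) /\ `|h' s| <= M.
  apply: contrapT => nh; apply: nN's; left; apply: Nh => /=.
  by apply/not_implyP; split => //; apply/andP.
have [r r0 hr] : exists2 r, 0 < r & forall t, `|t - s| < r ->
    `|h t - h s| <= (M + e1) * `|t - s|.
  have [/= dh hE] := ds.
  move: dh => /cvg_ex[/= l hl].
  have ls : l = h' s by rewrite -hE; apply/esym/cvg_lim.
  move: hl => /cvgrPdist_le/(_ e1 e10)/nbhs_ballP[r /= r0 hr].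
  exists r => // t tsr.
  have [->|ts] := eqVneq t s; first by rewrite !subrr normr0 mulr0.
  have ts0 : t - s != 0 by rewrite subr_eq0.
  have := hr (t - s); rewrite /ball/= sub0r normrN => /(_ tsr ts0).
  rewrite [_%:A]mulr1 subrK ls => H.
  have -> : h t - h s = ((t - s)^-1 * (h t - h s)) * (t - s).
    by rewrite mulrAC mulVf// mul1r.
  rewrite normrM ler_wpM2r//.
  set q := _ * _ in H *.
  have -> : q = h' s - (h' s - q) by ring.
  rewrite (le_trans (ler_normB _ _))// lerD//.
exists r => // t t' /andP[ut ts] /andP[st' t'v] srt t'sr [n [c [d' [cd tcd hvu]]]].
exists n, c, d'; split => //.
  move=> i; have [[H1 H2] H3] := cd i; split => //; split => //.
  by rewrite (le_trans H2)// (le_trans ts).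
have H1 := hr t; have H2 := hr t'.
rewrite distrC (distrC (h t)) (@ger0_norm _ (s - t)) ?subr_ge0// in H1.
rewrite (@ger0_norm _ (t' - s)) ?subr_ge0// in H2.
have {}H1 : `|h s - h t| <= (M + e1) * (s - t) by apply: H1; lra.
have {}H2 : `|h t' - h s| <= (M + e1) * (t' - s) by apply: H2; lra.
have -> : h t' - h u = (h t - h u) + (h s - h t) + (h t' - h s) by ring.
rewrite (le_trans (ler_normD _ _))//.
have := ler_normD (h t - h u) (h s - h t).
lra.
Qed.

(** * Primitives and the fundamental theorem of calculus *)

Lemma bounded_integrable (R : realType) (k : R -> R) (K : R) (A : set R) :
  measurable_fun [set: R] k -> (forall x, `|k x| <= K) ->
  measurable A -> (lebesgue_measure A < +oo)%E ->
  (@lebesgue_measure R).-integrable A (EFin \o k).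
Proof.
move=> mk kK mA Ay; apply: measurable_bounded_integrable => //.
  exact: measurable_funTS.
exists K; split; first exact: num_real.
by move=> M KM x _ /=; rewrite (le_trans (kK x))// ltW.
Qed.

Lemma itv_measure_lty (R : realType) (b1 b2 : bool) (u v : R) :
  (lebesgue_measure ([set` Interval (BSide b1 u) (BSide b2 v)] : set R) < +oo)%E.
Proof. by rewrite lebesgue_measure_itv/=; case: ifP => _; rewrite ?ltry// -EFinB ltry. Qed.

(** Integrating from a moving base point - |x| - 1 and normalising at 0 gives
    one function G on the whole line whose increments are integrals of k, without
    any integrability of k at infinity. *)
Lemma bounded_primitive (R : realType) (k : R -> R) (K : R) :
  measurable_fun [set: R] k -> (forall x, `|k x| <= K) ->
  exists G : R -> R,
    [/\ forall u v, u <= v -> (`|G v - G u|%:E <=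
          \int[lebesgue_measure]_(x in `[u, v]) `|k x|%:E)%E,
        forall u v, `|G v - G u| <= K * `|v - u| &
        forall x, lebesgue_pt k x -> is_derive x (1 : R) G (k x)].
Proof.
move=> mk kK.
have ik b1 b2 (u v : R) : (@lebesgue_measure R).-integrable
    [set` Interval (BSide b1 u) (BSide b2 v)] (EFin \o k).
  by apply: (bounded_integrable mk kK) => //; exact: itv_measure_lty.
pose Phi m x := (\int[@lebesgue_measure R]_(t in `]m, x]) k t)%R.
have PhiD m m' x : m <= m' -> m' <= x -> Phi m x = Phi m m' + Phi m' x.
  move=> mm' m'x; rewrite /Phi -(@Rintegral_itvB _ k (BRight m) (BRight x) m') //.
  by rewrite addrC subrK.
pose G x := Phi (- `|x| - 1) x - Phi (- `|x| - 1) 0.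
(* any base point to the left of x and 0 gives the same value of G *)
have GE m x : m <= x -> m <= 0 -> G x = Phi m x - Phi m 0.
  move=> mx m0; rewrite /G; set m1 := - `|x| - 1.
  have m1x : m1 <= x by rewrite /m1; have := ler_norm (- x); rewrite normrN; lra.
  have m10 : m1 <= 0 by rewrite /m1; have := normr_ge0 x; lra.
  have [mm1|/ltW m1m] := leP m m1.
    by rewrite (PhiD m m1 x)// (PhiD m m1 0)//; ring.
  by rewrite (PhiD m1 m x)// (PhiD m1 m 0)//; ring.
have GB u v : u <= v -> G v - G u = Phi u v.
  move=> uv; pose m := Num.min u 0.
  have mu : m <= u by rewrite /m ge_min lexx.
  have m0 : m <= 0 by rewrite /m ge_min lexx orbT.
  have mv := le_trans mu uv.
  by rewrite (GE m v mv m0) (GE m u mu m0) (PhiD m u v mu uv); ring.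
have Gint u v : u <= v -> (`|G v - G u|%:E <=
    \int[lebesgue_measure]_(x in `]u, v]) `|k x|%:E)%E.
  move=> uv; rewrite GB// /Phi EFin_normr_Rintegral//.
  by apply: le_abse_integral => //; apply/measurable_EFinP/measurable_funTS.
exists G; split.
- move=> u v /Gint/le_trans; apply; apply: ge0_subset_integral => //.
    apply/measurable_EFinP/measurable_funTS/measurableT_comp => //; exact: mk.
  by move=> x; rewrite /= !in_itv/= => /andP[/ltW -> ->].
- have K0 : 0 <= K by rewrite (le_trans (normr_ge0 _) (kK 0)).
  have Gle u v : u <= v -> `|G v - G u| <= K * `|v - u|.
    move=> uv; rewrite -lee_fin (le_trans (Gint _ _ uv))//.
    apply: (@le_trans _ _ (\int[lebesgue_measure]_(x in `]u, v]) K%:E)%E).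
      apply: ge0_le_integral => //.
        apply/measurable_EFinP/measurable_funTS/measurableT_comp => //; exact: mk.
      by move=> x _; rewrite lee_fin.
    rewrite integral_cst// [X in (_ * X)%E]lebesgue_measure_itv/= lte_fin ger0_norm ?subr_ge0//.
    case: ltP => _; first by rewrite -EFinB -EFinM.
    by rewrite mule0 lee_fin mulr_ge0// subr_ge0.
  move=> u v; have [/Gle//|/ltW/Gle] := leP u v.
  by rewrite distrC (distrC v).
- move=> x kx; pose m := Num.min x 0 - 1.
  have mx : m < x by rewrite /m ltrBlDr gt_min ltrDl ltr01.
  have m0 : m <= 0 by rewrite /m lerBlDr add0r ge_min ler01 orbT.
  have [dP PE] := @FTC1_lebesgue_pt _ k (BRight m) x (x + 1) ltac:(by rewrite ltrDl)
    (ik _ _ _ _) mx kx.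
  have dPhi : is_derive x (1 : R) (Phi m) (k x).
    by constructor => //; rewrite -derive1E.
  apply: (@near_eq_is_derive _ _ _ (fun y => Phi m y - cst (Phi m 0) y)).
    near=> y; rewrite (GE m y)//.
    by near: y; exact: filterS (fun y => @ltW _ _ m y) (lt_nbhsr mx).
  by apply: is_derive_eq; rewrite subr0.
Unshelve. all: by end_near. Qed.

Lemma is_derive_norm_le (R : realType) (g : R -> R) (x l K : R) :
  is_derive x (1 : R) g l ->
  (\forall y \near x, `|g y - g x| <= K * `|y - x|) -> `|l| <= K.
Proof.
move=> [/cvg_ex[/= l' gl'] gl] gK.
have {}l'l : l' = l by rewrite -gl; apply/esym/cvg_lim.
rewrite {}l'l in gl'.
apply: (cvgr_to_le (cvg_norm gl')).
have : \forall h \near (0 : R)^', `|g (h + x) - g x| <= K * `|h|.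
  apply: nbhs_dnbhs; move/nbhs_ballP : gK => [r /= r0 gK].
  apply/nbhs_ballP; exists r => //= h; rewrite /ball/= sub0r normrN => hr.
  by have := gK (h + x); rewrite /ball/= opprD addrCA subrr addr0 normrN addrK; apply.
move=> H; near=> h.
have h0 : h != 0 by near: h; exact: nbhs_dnbhs_neq.
rewrite [_%:A]mulr1 normrZ normfV mulrC ler_pdivrMr ?normr_gt0//.
by near: h.
Unshelve. all: by end_near. Qed.

(** One half of the fundamental theorem of calculus, for a Lipschitz g that is
    differentiable almost everywhere.  The primitive G of k is Lipschitz and, by
    Lebesgue differentiation, has derivative k almost everywhere; hence g - G is
    Lipschitz with derivative 0 almost everywhere, so by [abs_continuous_le] it
    takes the same value at u and at v. *)
Lemma lipschitz_le_integral (R : realType) (g k : R -> R) (u v K : R) :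
  u <= v -> 0 <= K ->
  (forall x y, u <= x <= v -> u <= y <= v -> `|g x - g y| <= K * `|x - y|) ->
  measurable_fun (`[u, v] : set R) k ->
  (\forall x \ae (@lebesgue_measure R), u < x < v -> is_derive x (1 : R) g (k x)) ->
  (`|g v - g u|%:E <= \int[lebesgue_measure]_(x in `[u, v]) `|k x|%:E)%E.
Proof.
move=> uv K0 gK mk gk.
(* k is a derivative of g almost everywhere, so truncating it at the
   Lipschitz constant changes it on a null set only *)
pose A : set R := `[u, v] `&` [set x | `|k x| <= K].
have mA : measurable A.
  have mnk : measurable_fun (`[u, v] : set R) (fun x => `|k x|).
    exact: measurableT_comp.
  have := mnk (measurable_itv _) _ (measurable_itv `]-oo, K]).
  by rewrite (_ : _ @^-1` _ = [set x | `|k x| <= K])//; apply/seteqP; split => x /=; rewrite in_itv.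
pose k1 := k \_ A.
have k1E x : u <= x <= v -> `|k x| <= K -> k1 x = k x.
  by move=> uxv kxK; rewrite /k1 patchE mem_set.
have mk1 : measurable_fun [set: R] k1.
  apply/(measurable_restrictT _ mA).
  by apply: (@measurable_funS _ _ _ _ (`[u, v] : set R)) => //; exact: subIsetl.
have k1K x : `|k1 x| <= K.
  by rewrite /k1 patchE; case: ifPn => [/set_mem[]//|_]; rewrite normr0.
have [G [Gint GK dG]] := bounded_primitive mk1 k1K.
have gG : `|(g v - G v) - (g u - G u)| <= 0 * (v - u).
  apply: (@abs_continuous_le _ (fun x => g x - G x) (fun=> 0)) => //.
    apply: (@lipschitz_abs_continuous_on _ _ _ (K + K)) => x y xuv yuv.
    have -> : (g x - G x) - (g y - G y) = (g x - g y) - (G x - G y) by ring.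
    rewrite (le_trans (ler_normB _ _))// mulrDl lerD//.
    by apply: gK; [move: xuv|move: yuv]; rewrite /= in_itv.
  have lk1 : locally_integrable [set: R] k1.
    split => //; first exact: openT.
    move=> C _ cC; have mC := compact_measurable cC.
    have /integrableP[_] := bounded_integrable mk1 k1K mC (compact_finite_measure cC).
    exact.
  have aeF := ae_filter_ringOfSetsType (@lebesgue_measure R).
  have := lebesgue_differentiation lk1.
  move: gk; apply: filterS2 => x gk k1x uxv.
  split; last by rewrite normr0.
  have dg := gk uxv; have dGx := dG _ k1x.
  have kx : k1 x = k x.
    apply: k1E; first by case/andP: uxv => /ltW -> /ltW ->.
    apply: (is_derive_norm_le dg).
    case/andP: uxv => ux xv; near=> y; apply: gK; last by rewrite !ltW.
    apply/andP; split; near: y.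
      exact: filterS (fun y => @ltW _ _ u y) (lt_nbhsr ux).
    exact: filterS (fun y => @ltW _ _ y v) (lt_nbhsl xv).
  by apply: is_derive_eq; rewrite kx subrr.
have -> : g v - g u = G v - G u.
  by move: gG; rewrite mul0r normr_le0 subr_eq0 => /eqP ?; lra.
apply: (le_trans (Gint _ _ uv)); apply: ge0_le_integral => //.
- apply/measurable_EFinP/measurable_funTS/measurableT_comp => //; exact: mk1.
- by apply/measurable_EFinP/measurableT_comp => //.
- move=> x _; rewrite lee_fin /k1 patchE; case: ifPn => // _.
  by rewrite normr0.
Unshelve. all: by end_near. Qed.

Lemma lipschitz_within_continuous (R : realType) (A : set R) (f : R -> R) (L : R) :
  (forall x y, A x -> A y -> `|f x - f y| <= L * `|x - y|) ->
  {within A, continuous f}.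
Proof.
move=> fL; apply/subspace_continuousP => x Ax.
apply/cvgrPdist_le => e e0; have L1 : 0 < `|L| + 1 by rewrite ltr_wpDl.
near=> y.
have Ay : A y by near: y; exact: withinT.
rewrite (le_trans (fL _ _ Ax Ay))//.
have : `|x - y| <= e / (`|L| + 1).
  near: y; apply: cvg_within; apply/nbhs_ballP.
  exists (e / (`|L| + 1)); first exact: divr_gt0.
  by move=> y /ltW.
rewrite ler_pdivlMr// mulrC; apply: le_trans; rewrite ler_wpM2r//.
by rewrite (le_trans (ler_norm _))// lerDl.
Unshelve. all: by end_near. Qed.

Lemma lipschitz_measurable (R : realType) (A : set R) (f : R -> R) (L : R) :
  measurable A ->
  (forall x y, A x -> A y -> `|f x - f y| <= L * `|x - y|) ->
  measurable_fun A f.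
Proof.
move=> mA /lipschitz_within_continuous.
exact: subspace_continuous_measurable_fun.
Qed.

(** Extending f by 0 outside J makes it bounded and measurable on the line, and
    continuity of f at an interior point of J makes it a Lebesgue point. *)
Lemma lipschitz_primitive (R : realType) (J : set R) (f : R -> R) (L N : R) :
  measurable J -> 0 <= N ->
  (forall x y, J x -> J y -> `|f x - f y| <= L * `|x - y|) ->
  (forall x, J x -> `|f x| <= N) ->
  exists2 F : R -> R, forall x y, `|F x - F y| <= N * `|x - y| &
    forall x, J° x -> is_derive x (1 : R) F (f x).
Proof.
move=> mJ N0 fL fN.
have mf : measurable_fun [set: R] (f \_ J).
  apply/(measurable_restrictT _ mJ); exact: lipschitz_measurable fL.
have fJN x : `|(f \_ J) x| <= N.
  by rewrite patchE; case: ifPn => [/set_mem/fN//|_]; rewrite normr0.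
have [F [_ FN dF]] := bounded_primitive mf fJN.
exists F => [x y|x Jx]; first exact: FN.
have Jxx := interior_subset Jx.
have -> : f x = (f \_ J) x by rewrite patchE mem_set.
apply: dF; apply: (continuous_lebesgue_pt (U := setT)) => //.
  by split => //; exact: openT.
have /subspace_continuousP/(_ x Jxx) fx := lipschitz_within_continuous fL.
have fJx : (f \_ J) x = f x by rewrite patchE mem_set.
move=> B; rewrite /= fJx => /fx; rewrite /nbhs/= /within/=.
move: Jx; apply: filterS2 => y Jy /(_ Jy).
by rewrite /preimage/= patchE mem_set.
Qed.

(** A non-constant affine map pulls null sets back to null sets, because the
    image of Lebesgue measure under it, scaled by |D|, agrees with Lebesgue
    measure on half-open intervals. *)
Lemma affine_ae (R : realType) (P : R -> Prop) (x D : R) : D != 0 ->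
  (\forall z \ae (@lebesgue_measure R), P z) ->
  \forall s \ae (@lebesgue_measure R), P (x + s * D).
Proof.
move=> D0 [N [mN N0 PN]].
pose h : measurableTypeR R -> measurableTypeR R := fun s => x + s * D.
have mh : measurable_fun setT h by apply: measurable_funD => //; exact: measurable_funM.
pose mu : {measure set (measurableTypeR R) -> \bar R} :=
  mscale (NngNum (normr_ge0 D)) (pushforward lebesgue_measure h).
have muE A : measurable A -> lebesgue_measure A = mu mh A.
  apply: lebesgue_measure_unique => _ [[a b] _ <-].
  rewrite /mu /= /mscale /=.
  have hE : pushforward lebesgue_measure h `]a, b] = if D > 0
      then lebesgue_measure (`](a - x) / D, (b - x) / D] : set R)
      else lebesgue_measure (`[(b - x) / D, (a - x) / D[ : set R).
    rewrite /pushforward; case: ltgtP D0 => // D0 _; congr lebesgue_measure;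
      apply/seteqP; split => s; rewrite /h /= !in_itv/=.
    - by rewrite ltr_pdivrMr// ler_pdivlMr// => /andP[? ?]; apply/andP; split; lra.
    - by rewrite ltr_pdivrMr// ler_pdivlMr// => /andP[? ?]; apply/andP; split; lra.
    - by rewrite ler_ndivrMr// ltr_ndivlMr// => /andP[? ?]; apply/andP; split; lra.
    - by rewrite ler_ndivrMr// ltr_ndivlMr// => /andP[? ?]; apply/andP; split; lra.
  rewrite {}hE; case: ltgtP D0 => // D0 _; rewrite !lebesgue_measure_itv/= !lte_fin.
  - rewrite (gtr0_norm D0) ltr_pM2r ?invr_gt0// ltrD2r; case: ifP => _.
      by rewrite -!EFinB -EFinM; congr EFin; field; rewrite gt_eqF.
    by rewrite mule0.
  - rewrite (ltr0_norm D0) ltr_nM2r ?invr_lt0// ltrD2r; case: ifP => _.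
      by rewrite -!EFinB -EFinM; congr EFin; field; rewrite lt_eqF.
    by rewrite mule0.
exists (h @^-1` N); split.
- by rewrite -[X in measurable X]setTI; exact: (mh).
- have : mu mh N = 0%E by rewrite -muE.
  rewrite /mu /= /mscale /pushforward /= => /eqP.
  by rewrite mule_eq0 eqe normr_eq0 (negbTE D0)/= => /eqP.
- by move=> s /= nP; apply: PN.
Qed.

(** * Taylor's formula with integral remainder *)

Lemma segment_interior (R : realType) (J : set R) (x y s : R) :
  is_interval J -> J x -> J y -> x != y -> 0 < s < 1 ->
  J° (x + s * (y - x)).
Proof.
move=> iJ Jx Jy xy /andP[s0 s1].
have sub u v z : J u -> J v -> z \in `]u, v[ -> J° z.
  move=> Ju Jv /near_in_itvoo; apply: filterS => w.
  by rewrite in_itv/= => /andP[uw wv]; apply: (iJ u v) => //; rewrite !ltW.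
have [lt_xy|lt_yx] : x < y \/ y < x by apply/orP; rewrite -neq_lt.
- by apply: (sub x y) => //; rewrite in_itv/=; apply/andP; split; nra.
- by apply: (sub y x) => //; rewrite in_itv/=; apply/andP; split; nra.
Qed.

Lemma segment_subset (R : realType) (J : set R) (x y s : R) :
  is_interval J -> J x -> J y -> 0 <= s <= 1 -> J (x + s * (y - x)).
Proof.
move=> iJ Jx Jy /andP[s0 s1].
have [xy|/ltW yx] := leP x y.
- by apply: (iJ x y) => //; apply/andP; split; nra.
- by apply: (iJ y x) => //; apply/andP; split; nra.
Qed.

(** Taylor's formula at order two with integral remainder, when f' = F'' exists
    only almost everywhere.  Along the segment from x to y the function Psi below
    is the Taylor polynomial of F at the moving point, with the quadratic
    coefficient kept at f' x, evaluated at y.  Thus Psi 1 - Psi 0 is the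
    remainder, while all terms of its derivative cancel
    except D^2 (1 - s) (f' (x + s D) - f' x); [lipschitz_le_integral] applies
    to it. *)
Lemma taylor2_le (R : realType) (J : set R) (f f' F : R -> R) (L N : R) (x y : R) :
  is_interval J ->
  (forall u v, J u -> J v -> `|f u - f v| <= L * `|u - v|) ->
  (forall u, J u -> `|f u| <= N) ->
  derivative_version J f f' ->
  (forall u v, `|F u - F v| <= N * `|u - v|) ->
  (forall u, J° u -> is_derive u (1 : R) F (f u)) ->
  0 <= L ->
  J x -> J y ->
  (`|F y - F x - f x * (y - x) - (y - x) ^+ 2 / 2 * f' x|%:E <=
   ((y - x) ^+ 2)%:E * \int[lebesgue_measure]_(s in `[0%R, 1%R])
     ((1 - s) * `|f' x - f' (x + s * (y - x))|)%R%:E)%E.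
Proof.
move=> iJ fL fN [mf' df] FN dF L0 Jx Jy.
have mJ : measurable J by exact: is_interval_measurable.
have N0 : 0 <= N by rewrite (le_trans (normr_ge0 _) (fN x Jx)).
have [<-|xy] := eqVneq x y.
  rewrite !subrr expr2 !mul0r mulr0 !subr0 normr0.
  by rewrite mul0e.
set D := y - x.
have D0 : D != 0 by rewrite subr_eq0 eq_sym.
pose Psi s := F (x + s * D) + (f (x + s * D) * (1 - s) * D +
  f' x * D ^+ 2 / 2 * ((1 - s) ^+ 2)).
pose k s := D ^+ 2 * ((1 - s) * (f' (x + s * D) - f' x)).
pose K := N * `|D| + ((L * `|D| + N) * `|D| + `|f' x| * D ^+ 2).
have JD s : 0 <= s <= 1 -> J (x + s * D) by exact: segment_subset.
have aff s t : `|(x + s * D) - (x + t * D)| = `|D| * `|s - t|.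
  by rewrite -normrM; congr `|_|; ring.
have mfD : measurable_fun (`[0, 1] : set R) (fun s => f' (x + s * D)).
  apply: (measurable_comp mJ _ mf').
    by move=> _ [s /= s01 <-]; apply: JD; move: s01; rewrite in_itv.
  by apply: measurable_funD => //; exact: measurable_funM.
have mk : measurable_fun (`[0, 1] : set R) k.
  apply: measurable_funM => //; apply: measurable_funM.
    exact: measurable_funB.
  exact: measurable_funB.
have -> : F y - F x - f x * D - D ^+ 2 / 2 * f' x = Psi 1 - Psi 0.
  rewrite /Psi mul1r subrr mul0r addr0 subr0 (_ : x + D = y); last by rewrite /D; ring.
  by field.
(* K bounds the slope of Psi term by term *)
have PsiK s t : 0 <= s <= 1 -> 0 <= t <= 1 -> `|Psi s - Psi t| <= K * `|s - t|.
  move=> s01 t01.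
  have -> : Psi s - Psi t = (F (x + s * D) - F (x + t * D)) +
     (((f (x + s * D) - f (x + t * D)) * (1 - s) + f (x + t * D) * (t - s)) * D +
      f' x * D ^+ 2 / 2 * ((2 - s - t) * (t - s))).
    by rewrite /Psi; ring.
  rewrite (le_trans (ler_normD _ _))// /K [leRHS]mulrDl lerD//.
    by rewrite (le_trans (FN _ _))// aff mulrA.
  rewrite (le_trans (ler_normD _ _))// [leRHS]mulrDl lerD//.
    rewrite normrM [leRHS]mulrAC ler_wpM2r// [leRHS]mulrDl (le_trans (ler_normD _ _))// lerD//.
      rewrite normrM -[leRHS]mulr1 ler_pM//; last first.
        by case/andP: s01 => ? ?; rewrite ger0_norm; lra.
      by rewrite (le_trans (fL _ _ (JD _ s01) (JD _ t01)))// aff mulrA.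
    by rewrite normrM distrC ler_wpM2r// fN//; exact: JD.
  have -> : f' x * D ^+ 2 / 2 * ((2 - s - t) * (t - s)) =
      (f' x * D ^+ 2) * ((2 - s - t) / 2 * (t - s)) by field.
  rewrite normrM (normrM (f' x)) (@ger0_norm _ (D ^+ 2)) ?sqr_ge0//.
  apply: ler_wpM2l; first by rewrite mulr_ge0// sqr_ge0.
  rewrite normrM (distrC t) ler_piMl//.
  by case/andP: s01 => ? ?; case/andP: t01 => ? ?; rewrite ger0_norm; lra.
have K0 : 0 <= K.
  apply: addr_ge0; first exact: mulr_ge0.
  apply: addr_ge0; last by rewrite mulr_ge0// sqr_ge0.
  by rewrite mulr_ge0// addr_ge0// mulr_ge0.
have dPsi : \forall s \ae (@lebesgue_measure R), (0 < (s : R) < 1) ->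
    is_derive (s : R) (1 : R) Psi (k s).
  have aeF := ae_filter_ringOfSetsType (@lebesgue_measure R).
  have := affine_ae x D0 df; apply: filterS => s + s01.
  have Js := segment_interior iJ Jx Jy xy s01.
  move=> /(_ Js) dfs; have dFs := dF _ Js.
  have daff : is_derive s (1 : R) (fun s : R => x + s * D) D.
    by apply: is_derive_eq; rewrite scaler0 !add0r mul1r [_%:A]mulr1.
  have dFa := @is_derive1_comp _ F (fun s : R => x + s * D) s _ _ dFs daff.
  have dfa := @is_derive1_comp _ f (fun s : R => x + s * D) s _ _ dfs daff.
  have d1 : is_derive s (1 : R) (fun s : R => 1 - s) (- 1).
    have h1 : is_derive s (1 : R) (cst (1 : R)) 0 by exact: is_derive_cst.
    have h2 : is_derive s (1 : R) (@id R) 1 by exact: is_derive_id.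
    have := @is_deriveB _ _ _ _ _ s 1 _ _ h1 h2.
    by rewrite sub0r.
  have d2 := @is_deriveX _ _ (fun s : R => 1 - s) 2 s 1 _ d1.
  have d3 := @is_deriveM _ _ _ _ s 1 _ _ (@is_deriveM _ _ _ _ s 1 _ _ dfa d1)
    (is_derive_cst D s (1 : R)).
  have d4 := @is_deriveM _ _ _ _ s 1 _ _ (is_derive_cst (f' x * D ^+ 2 / 2) s (1 : R)) d2.
  have d5 := @is_deriveD _ _ _ _ _ s 1 _ _ dFa (@is_deriveD _ _ _ _ _ s 1 _ _ d3 d4).
  apply: (is_derive_eq d5).
  rewrite /k /= /GRing.scale /= !mulr0 !addr0 ?add0r expr1.
  by rewrite -/D; field.
apply: (le_trans (lipschitz_le_integral ler01 K0 PsiK mk dPsi)).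
rewrite -ge0_integralZl//; last 3 first.
- apply/measurable_EFinP; apply: measurable_funM; first exact: measurable_funB.
  by apply: measurableT_comp => //; exact: measurable_funB.
- move=> s /=; rewrite in_itv/= => /andP[_ s1].
  by rewrite lee_fin mulr_ge0// subr_ge0.
- by rewrite lee_fin sqr_ge0.
rewrite le_eqVlt; apply/orP; left; apply/eqP.
apply: eq_integral => s; rewrite inE/= in_itv/= => /andP[_ s1].
rewrite -EFinM; congr EFin; rewrite /k !normrM (@ger0_norm _ (1 - s)) ?subr_ge0//.
by rewrite -normrM -expr2 ger0_norm ?sqr_ge0// (distrC (f' x)).
Qed.

(** * Conditional expectations and bounded functions *)

Lemma integrableMl_bounded d (T : measurableType d) (R : realType)
    (P : {measure set T -> \bar R}) (h V : T -> R) (M : R) :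
  measurable_fun [set: T] h -> (forall w, `|h w| <= M) ->
  P.-integrable [set: T] (EFin \o V) ->
  P.-integrable [set: T] (EFin \o (fun w => h w * V w)).
Proof.
move=> mh hM iV; apply: (integrableMr measurableT mh _ iV).
exists M; split; first exact: num_real.
by move=> x Mx w _ /=; rewrite (le_trans (hM w))// ltW.
Qed.

(** A simple function of X is a finite combination of indicators of sets
    X^-1 B, against each of which V integrates to 0. *)
Lemma integral_nnsfun_mul_eq0 d (T : measurableType d) (R : realType)
    (P : {measure set T -> \bar R}) (X V : T -> R)
    (g : {nnsfun (measurableTypeR R) >-> R}) :
  measurable_fun [set: T] X ->
  P.-integrable [set: T] (EFin \o V) ->
  (forall B : set R, measurable B -> \int[P]_(w in X @^-1` B) (V w)%:E = 0)%E ->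
  (\int[P]_w (g (X w) * V w)%:E = 0)%E.
Proof.
move=> mX iV V0.
pose B (y : R) : set R := g @^-1` [set y].
have mB y : measurable (B y) by exact: (measurable_funPTI g (measurable_set1 y)).
have iI y : P.-integrable [set: T] (EFin \o (fun w => \1_(B y) (X w) * V w)).
  apply: (@integrableMl_bounded _ _ _ _ _ _ 1) => //.
    have m1 : measurable_fun [set: R] (\1_(B y) : R -> R) by apply: measurable_indic.
    exact: (measurableT_comp m1 mX).
  by move=> w; rewrite indicE; case: (_ \in _); rewrite ?normr1 ?normr0.
have J0 y : (\int[P]_w (\1_(B y) (X w) * V w)%:E = 0)%E.
  rewrite -(V0 (B y))// [RHS]integral_mkcond.
  apply: eq_integral => w _; rewrite patchE indicE.
  rewrite (_ : (w \in X @^-1` B y) = (X w \in B y)).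
    by case: ifPn => _; rewrite ?mul1r ?mul0r.
  by apply/idP/idP; rewrite !inE.
under eq_integral => w _.
  rewrite fimfunEord mulr_suml -sumEFin.
  under eq_bigr do rewrite -mulrA EFinM.
  over.
rewrite integral_sum//; last first.
  move=> i; apply: integrableZl => //.
  exact: iI.
rewrite big1// => i _; rewrite integralZl//; last first.
  exact: iI.
by rewrite [X in (_ * X)%E](J0 _) mule0.
Qed.

(** Extends the vanishing of the integral of V on the sets X^-1 B to bounded
    functions of X: dominated convergence along simple approximations handles
    nonnegative phi, and phi + M reduces the general case to that one since V
    itself integrates to 0. *)
Lemma integral_bounded_mul_eq0 d (T : measurableType d) (R : realType)
    (P : probability T R) (X V : T -> R) (phi : R -> R) (M : R) :
  measurable_fun [set: T] X ->
  P.-integrable [set: T] (EFin \o V) ->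
  (forall B : set R, measurable B -> \int[P]_(w in X @^-1` B) (V w)%:E = 0)%E ->
  measurable_fun [set: R] phi -> (forall x, `|phi x| <= M) ->
  (\int[P]_w (phi (X w) * V w)%:E = 0)%E.
Proof.
move=> mX iV V0 mphi phiM.
have mphiX : measurable_fun [set: T] (fun w => phi (X w)) by exact: measurableT_comp.
have ge0_case (psi : R -> R) (M' : R) : measurable_fun [set: R] psi -> (forall x, 0 <= psi x <= M') ->
    (\int[P]_w (psi (X w) * V w)%:E = 0)%E.
  move=> mpsi psiM.
  have mpsie : measurable_fun [set: measurableTypeR R] (EFin \o psi).
    exact/measurable_EFinP.
  have psi0 (x : measurableTypeR R) : [set: measurableTypeR R] x -> (0 <= (EFin \o psi) x)%E.
    by move=> _; rewrite lee_fin; case/andP: (psiM x).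
  pose g n : {nnsfun (measurableTypeR R) >-> R} := nnsfun_approx measurableT mpsie n.
  have gpsi n x : g n x <= psi x.
    by rewrite -lee_fin /g nnsfun_approxE; exact: (le_approx n psi0).
  have cvg_gpsi x : EFin \o g ^~ x @ \oo --> (psi x)%:E.
    exact: (cvg_nnsfun_approx measurableT mpsie psi0).
  have mV : measurable_fun [set: T] V.
    by case/integrableP : iV => /measurable_EFinP.
  have mpsiX : measurable_fun [set: T] (fun w => psi (X w)) by exact: measurableT_comp.
  have mgX n : measurable_fun [set: T] (fun w => g n (X w)).
    have mg : measurable_fun [set: measurableTypeR R] (g n) by exact: measurable_funPT.
    exact: (measurableT_comp mg mX).
  have [] := @dominated_convergence _ _ _ P [set: T] measurableT
    (fun n w => (g n (X w) * V w)%:E) (fun w => (psi (X w) * V w)%:E)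
    (fun w => M'%:E * `|V w|%:E)%E.
  - by move=> n; apply/measurable_EFinP; exact: measurable_funM.
  - by apply/measurable_EFinP; exact: measurable_funM.
  - apply: aeW => w _; under eq_fun do rewrite EFinM; rewrite EFinM.
    by apply: cvgeZr => //; exact: cvg_gpsi.
  - by apply: integrableZl => //; exact: (integrable_abse iV).
  - apply: aeW => w n _; rewrite -EFinM lee_fin normrM ler_wpM2r//.
    rewrite ger0_norm; last exact: fun_ge0.
    by rewrite (le_trans (gpsi _ _))//; case/andP: (psiM (X w)).
  move=> _ _; under eq_fun do rewrite (integral_nnsfun_mul_eq0 _ mX iV V0).
  by move/cvg_lim => <- //; rewrite lim_cst.
have mphiM : measurable_fun [set: R] (fun x => phi x + M) by exact: measurable_funD.
have := ge0_case _ (M + M) mphiM.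
have iphi : P.-integrable [set: T] (EFin \o (fun w => phi (X w) * V w)).
  by apply: (@integrableMl_bounded _ _ _ _ _ _ M).
have VT : (\int[P]_w (V w)%:E = 0)%E by exact: (V0 setT).
under eq_integral do rewrite mulrDl EFinD EFinM -EFinM.
rewrite integralD//; last first.
  by apply: (@integrableMl_bounded _ _ _ _ _ _ M) => // w; rewrite ger0_norm// (le_trans _ (phiM 0)).
under [X in (_ + X)%E]eq_integral do rewrite EFinM.
rewrite integralZl// VT mule0 adde0; apply=> x.
by have := phiM x; rewrite ler_norml => /andP[? ?]; apply/andP; split; lra.
Qed.

(** Bounded functions of X can be taken out of a conditional expectation given
    X; written with the difference Z - Y so that a single integral vanishes. *)
Lemma cond_expectation_bounded d (T : measurableType d) (R : realType)
    (P : probability T R) (X : {RV P >-> R}) (Y Z : T -> R) (phi : R -> R) (M : R) :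
  P.-integrable [set: T] (EFin \o Y) ->
  cond_expectation_version P X Y Z ->
  measurable_fun [set: R] phi -> (forall x, `|phi x| <= M) ->
  (\int[P]_w (phi (X w) * (Z w - Y w))%:E = 0)%E.
Proof.
move=> iY [iZ _ YZ] mphi phiM.
apply: (@integral_bounded_mul_eq0 _ _ _ _ _ _ _ M) => //.
  exact: (integrableB measurableT iZ iY).
move=> B mB.
have mXB : measurable (X @^-1` B) by exact: measurable_funPTI.
rewrite integralB_EFin//; [|exact: integrableS iZ|exact: integrableS iY].
rewrite YZ; last by exists B => //; rewrite setTI.
by rewrite subee// integrable_fin_num//; exact: integrableS iY.
Qed.

(** * Integrals of identically distributed variables *)

(** The integral of a nonnegative function is a supremum over the simple
    functions below it, so it is monotone without measurability.  This allows
    bounds by functions that are themselves parametrised integrals. *)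
Lemma ge0_le_integral_nomeas d (T : measurableType d) (R : realType)
    (m : {measure set T -> \bar R}) (D : set T) (f g : T -> \bar R) :
  (forall x, D x -> 0 <= f x)%E -> (forall x, D x -> f x <= g x)%E ->
  (\int[m]_(x in D) f x <= \int[m]_(x in D) g x)%E.
Proof.
move=> f0 fg.
have g0 x : D x -> (0 <= g x)%E by move=> Dx; exact: le_trans (f0 x Dx) (fg x Dx).
rewrite !ge0_integralE//; apply: ereal_sup_le => _ [h hf <-].
exists h => // x; apply: le_trans (hf x) _; rewrite !patchE.
by case: ifPn => // /set_mem; exact: fg.
Qed.

Lemma ae_eq_integrable d (T : measurableType d) (R : realType)
    (m : {measure set T -> \bar R}) (f g : T -> R) :
  measurable_fun [set: T] f -> measurable_fun [set: T] g ->
  (\forall x \ae m, f x = g x) ->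
  m.-integrable [set: T] (EFin \o f) -> m.-integrable [set: T] (EFin \o g).
Proof.
move=> mf mg fg /integrableP[_ fy]; apply/integrableP; split.
  exact/measurable_EFinP.
rewrite (_ : (\int[m]_x `|(EFin \o g) x| = \int[m]_x `|(EFin \o f) x|)%E)//.
apply: ge0_ae_eq_integral => //.
- by apply: measurableT_comp => //; exact/measurable_EFinP.
- by apply: measurableT_comp => //; exact/measurable_EFinP.
- have aeF := ae_filter_ringOfSetsType m.
  by move: fg; apply: filterS => x /= -> _.
Qed.

Lemma integrable_of_sqr d (T : measurableType d) (R : realType)
    (P : probability T R) (X : T -> R) :
  measurable_fun [set: T] X ->
  P.-integrable [set: T] (EFin \o (fun w => X w ^+ 2)) ->
  P.-integrable [set: T] (EFin \o X).
Proof.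
move=> mX iX2.
have i1 := finite_measure_integrable_cst P 1 measurableT.
apply: (le_integrable measurableT _ _ (integrableD measurableT i1 iX2)).
  exact/measurable_EFinP.
move=> w _; rewrite lee_fin [leRHS]ger0_norm ?addr_ge0 ?sqr_ge0//=.
by rewrite -(real_normK (num_real (X w))); nra.
Qed.

Lemma identically_distributed_integral d (T : measurableType d) (R : realType)
    (P : probability T R) (X Y : {RV P >-> R}) (h : R -> R) :
  (forall A : set R, measurable A -> distribution P X A = distribution P Y A) ->
  measurable_fun [set: R] h ->
  P.-integrable [set: T] (EFin \o (fun w => h (X w))) ->
  P.-integrable [set: T] (EFin \o (fun w => h (Y w))) /\
  (\int[P]_w (h (Y w))%:E = \int[P]_w (h (X w))%:E)%E.
Proof.
move=> XY mh iX.
have mhe : measurable_fun [set: measurableTypeR R] (EFin \o h) by exact/measurable_EFinP.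
have mhn : measurable_fun [set: measurableTypeR R] (abse \o (EFin \o h)) by exact: measurableT_comp.
have XYint (k : measurableTypeR R -> \bar R) :
    (\int[distribution P X]_y k y = \int[distribution P Y]_y k y)%E.
  by apply: eq_measure_integral => A mA _; exact: XY.
have iY : P.-integrable [set: T] (EFin \o (fun w => h (Y w))).
  case/integrableP : iX => _ iX; apply/integrableP; split.
    by apply/measurable_EFinP; apply: measurableT_comp => //; exact: measurable_funPT.
  have /= <- := @ge0_integral_distribution _ _ _ _ _ P Y _ mhn (fun=> abse_ge0 _).
  rewrite -XYint.
  by have /= -> := @ge0_integral_distribution _ _ _ _ _ P X _ mhn (fun=> abse_ge0 _).
split => //.
have /= <- := @integral_distribution _ _ _ _ _ P Y _ mhe iY.
have /= <- := @integral_distribution _ _ _ _ _ P X _ mhe iX.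
by rewrite XYint.
Qed.

(** * The bound for a pair with the regression property *)

Lemma integrable_scale d (T : measurableType d) (R : realType)
    (P : {measure set T -> \bar R}) (k : R) (f : T -> R) :
  P.-integrable [set: T] (EFin \o f) ->
  P.-integrable [set: T] (EFin \o (fun w => k * f w)).
Proof. exact: integrableZl. Qed.

Lemma integral_scale d (T : measurableType d) (R : realType)
    (P : {measure set T -> \bar R}) (k : R) (f : T -> R) :
  P.-integrable [set: T] (EFin \o f) ->
  (\int[P]_w (k * f w)%:E = k%:E * \int[P]_w (f w)%:E)%E.
Proof. by move=> fi; rewrite -integralZl//; apply: eq_integral => w _; rewrite EFinM. Qed.

(** The probabilistic core.  Since W and W' have the same law, F (W') - F (W)
    has mean 0; phi0 (W) and phi1 (W) can be taken out of E[W' - W | W] and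
    E[(W' - W)^2 | W].  Subtracting these three centred terms from
    e phi1 (W) + g phi0 (W) leaves the three terms of the bound: the error of
    e as an approximation of E[(W' - W)^2 | W] / (2 lambda), the Taylor
    remainder X, and Rem. *)
Lemma identically_distributed_pair_bound d (T : measurableType d) (R : realType)
  (P : probability T R) (W W' : {RV P >-> R})
  (W_W'_id : forall A : set R, measurable A ->
     distribution P W A = distribution P W' A)
  (W_L2 : P.-integrable [set: T] (EFin \o (fun w => W w ^+ 2)))
  (g e : T -> R) (mg : measurable_fun [set: T] g) (me : measurable_fun [set: T] e)
  (ig : P.-integrable [set: T] (EFin \o g))
  (CE1 CE2 : T -> R)
  (CE1_def : cond_expectation_version P W (fun w => W' w - W w) CE1)
  (CE2_def : cond_expectation_version P W (fun w => (W' w - W w) ^+ 2) CE2)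
  (lambda : R) (lambda_gt0 : 0 < lambda) (Rem : {RV P >-> R})
  (regression : \forall w \ae P, CE1 w = lambda * g w + Rem w)
  (F phi0 phi1 : R -> R) (N M1 : R)
  (FN : forall x y, `|F x - F y| <= N * `|x - y|)
  (mphi0 : measurable_fun [set: R] phi0) (mphi1 : measurable_fun [set: R] phi1)
  (phi0N : forall x, `|phi0 x| <= N) (phi1M : forall x, `|phi1 x| <= M1) :
  (`| \int[P]_w (e w * phi1 (W w) + g w * phi0 (W w))%:E | <=
     M1%:E * \int[P]_w `|e w - (2 * lambda)^-1 * CE2 w|%:E
     + (lambda^-1)%:E * \int[P]_w `|F (W' w) - F (W w)
           - phi0 (W w) * (W' w - W w) - (W' w - W w) ^+ 2 / 2 * phi1 (W w)|%:E
     + N%:E * (lambda^-1)%:E * \int[P]_w `|Rem w|%:E)%E.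
Proof.
have lV0 : 0 <= lambda^-1 by rewrite invr_ge0 ltW.
have N0 : 0 <= N by exact: le_trans (phi0N 0).
have M10 : 0 <= M1 by exact: le_trans (phi1M 0).
have mW : measurable_fun [set: T] W by exact: measurable_funPT.
have mW' : measurable_fun [set: T] W' by exact: measurable_funPT.
have mRem : measurable_fun [set: T] Rem by exact: measurable_funPT.
have mF : measurable_fun [set: R] F.
  by apply: (lipschitz_measurable (L := N)) => // x y _ _; exact: FN.
have mphi0W : measurable_fun [set: T] (fun w => phi0 (W w)) by exact: measurableT_comp.
have mphi1W : measurable_fun [set: T] (fun w => phi1 (W w)) by exact: measurableT_comp.
have iW : P.-integrable [set: T] (EFin \o W) by exact: integrable_of_sqr.
have [iW' _] := identically_distributed_integral W_W'_id (@measurable_id _ _ setT) iW.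
have msq : measurable_fun [set: R] (fun x : R => x ^+ 2) by exact: measurable_funX.
have [iW'2 _] := identically_distributed_integral W_W'_id msq W_L2.
have iD : P.-integrable [set: T] (EFin \o (fun w => W' w - W w)).
  exact: (integrableB measurableT iW' iW).
have iD2 : P.-integrable [set: T] (EFin \o (fun w => (W' w - W w) ^+ 2)).
  have iS := integrable_scale 2 (integrableD measurableT iW'2 W_L2).
  apply: (le_integrable measurableT _ _ iS).
    by apply/measurable_EFinP; apply: measurable_funX; exact: measurable_funB.
  move=> w _; rewrite lee_fin /= !ger0_norm ?sqr_ge0 ?mulr_ge0 ?addr_ge0 ?sqr_ge0//.
  by have := sqr_ge0 (W' w + W w); nra.
have iFW : P.-integrable [set: T] (EFin \o (fun w => F (W w))).
  have i1 := finite_measure_integrable_cst P `|F 0| measurableT.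
  have iS := integrableD measurableT i1 (integrable_scale N (integrable_abse iW)).
  apply: (le_integrable measurableT _ _ iS).
    by apply/measurable_EFinP; exact: measurableT_comp.
  move=> w _; rewrite lee_fin /= [leRHS]ger0_norm ?addr_ge0 ?mulr_ge0//.
  have -> : F (W w) = F 0 + (F (W w) - F 0) by ring.
  by rewrite (le_trans (ler_normD _ _))// lerD// (le_trans (FN _ _))// subr0.
have [iFW' EF] := identically_distributed_integral W_W'_id mF iFW.
have [iCE1 _ _] := CE1_def; have [iCE2 _ _] := CE2_def.
have iRem : P.-integrable [set: T] (EFin \o Rem).
  apply: (@ae_eq_integrable _ _ _ _ (fun w => CE1 w - lambda * g w)) => //.
  - apply: measurable_funB; last exact: measurable_funM.
    by case/integrableP : iCE1 => /measurable_EFinP.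
  - have aeF := ae_filter_ringOfSetsType P.
    by move: regression; apply: filterS => w ->; ring.
  - exact: (integrableB measurableT iCE1 (integrable_scale lambda ig)).
have mCE2 : measurable_fun [set: T] CE2.
  by case/integrableP : iCE2 => /measurable_EFinP.
pose c := (2 * lambda)^-1.
pose E w := e w - c * CE2 w.
have mE : measurable_fun [set: T] E.
  by apply: measurable_funB => //; exact: measurable_funM.
pose X w := F (W' w) - F (W w) - phi0 (W w) * (W' w - W w)
  - (W' w - W w) ^+ 2 / 2 * phi1 (W w).
have mX : measurable_fun [set: T] X.
  apply: measurable_funB.
    apply: measurable_funB; last by apply: measurable_funM => //; exact: measurable_funB.
    by apply: measurable_funB; exact: measurableT_comp.
  apply: measurable_funM => //; apply: measurable_funM => //.
  by apply: measurable_funX; exact: measurable_funB.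
have iphi1 (V : T -> R) : P.-integrable [set: T] (EFin \o V) ->
    P.-integrable [set: T] (EFin \o (fun w => phi1 (W w) * V w)).
  exact: (@integrableMl_bounded _ _ _ _ _ _ M1).
have iphi0 (V : T -> R) : P.-integrable [set: T] (EFin \o V) ->
    P.-integrable [set: T] (EFin \o (fun w => phi0 (W w) * V w)).
  exact: (@integrableMl_bounded _ _ _ _ _ _ N).
have iX : P.-integrable [set: T] (EFin \o X).
  have iXq := integrable_scale 2^-1 (iphi1 _ iD2).
  have := integrableB measurableT (integrableB measurableT (integrableB measurableT iFW' iFW)
    (iphi0 _ iD)) iXq.
  by apply: eq_integrable => // w _; rewrite /= -!EFinB; congr EFin; rewrite /X; ring.
(* either the first term is integrable, or it is infinite with a positive
   factor and the right-hand side is +oo *)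
have [iA|[M1gt0 Eoo]] : P.-integrable [set: T] (EFin \o (fun w => phi1 (W w) * E w)) \/
    0 < M1 /\ (\int[P]_w `|E w|%:E = +oo)%E.
  have [M1E|M1n0] := eqVneq M1 0.
    left; have := finite_measure_integrable_cst P 0 measurableT.
    apply: eq_integrable => // w _ /=; have := phi1M (W w).
    by rewrite M1E normr_le0 => /eqP ->; rewrite mul0r.
  have [Eoo|] := leP +oo%E (\int[P]_w `|E w|%:E)%E.
    by right; split; [rewrite lt_neqAle eq_sym M1n0|apply/eqP; rewrite eq_le leey].
  move=> Ey; left; apply: iphi1; apply/integrableP; split => //.
  exact/measurable_EFinP.
- pose Z0 w := phi0 (W w) * (CE1 w - (W' w - W w)).
  pose Z1 w := phi1 (W w) * (CE2 w - (W' w - W w) ^+ 2).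
  pose B w := phi0 (W w) * Rem w.
  have iB : P.-integrable [set: T] (EFin \o B) by exact: iphi0.
  have iZ0 : P.-integrable [set: T] (EFin \o Z0).
    exact: (iphi0 _ (integrableB measurableT iCE1 iD)).
  have iZ1 : P.-integrable [set: T] (EFin \o Z1).
    exact: (iphi1 _ (integrableB measurableT iCE2 iD2)).
  have iDF : P.-integrable [set: T] (EFin \o (fun w => F (W' w) - F (W w))).
    exact: (integrableB measurableT iFW' iFW).
  have EZ0 : (\int[P]_w (Z0 w)%:E = 0)%E.
    exact: (cond_expectation_bounded iD CE1_def mphi0 phi0N).
  have EZ1 : (\int[P]_w (Z1 w)%:E = 0)%E.
    exact: (cond_expectation_bounded iD2 CE2_def mphi1 phi1M).
  have EDF : (\int[P]_w (F (W' w) - F (W w))%:E = 0)%E.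
    by rewrite integralB_EFin// EF subee// integrable_fin_num.
  pose A w := phi1 (W w) * E w.
  (* by the regression identity U is the integrand almost surely; its last
     three summands have mean 0 *)
  pose U w := A w + (- lambda^-1 * B w + (- lambda^-1 * X w + (c * Z1 w +
    (lambda^-1 * Z0 w + lambda^-1 * (F (W' w) - F (W w)))))).
  have iU5 := integrableD measurableT (integrable_scale lambda^-1 iZ0)
    (integrable_scale lambda^-1 iDF).
  have iU4 := integrableD measurableT (integrable_scale c iZ1) iU5.
  have iU3 := integrableD measurableT (integrable_scale (- lambda^-1) iX) iU4.
  have iU2 := integrableD measurableT (integrable_scale (- lambda^-1) iB) iU3.
  have iU := integrableD measurableT iA iU2.
  have EU : (\int[P]_w (e w * phi1 (W w) + g w * phi0 (W w))%:E = \int[P]_w (U w)%:E)%E.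
    apply: ae_eq_integral => //.
    - by apply/measurable_EFinP; apply: measurable_funD; exact: measurable_funM.
    - by case/integrableP : iU.
    - have aeF := ae_filter_ringOfSetsType P.
      move: regression; apply: filterS => w CE1w _; congr EFin.
      rewrite /U /A /E /B /X /Z1 /Z0 /c CE1w; field.
      by rewrite gt_eqF.
  have EUE : (\int[P]_w (U w)%:E = \int[P]_w (A w)%:E +
      ((- lambda^-1)%:E * \int[P]_w (B w)%:E + (- lambda^-1)%:E * \int[P]_w (X w)%:E))%E.
    rewrite (integralD_EFin measurableT iA iU2) (integralD_EFin measurableT _ iU3) ?integrable_scale//.
    rewrite (integralD_EFin measurableT _ iU4) ?integrable_scale//.
    rewrite (integralD_EFin measurableT _ iU5) ?integrable_scale//.
    rewrite (integralD_EFin measurableT) ?integrable_scale//.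
    rewrite !integral_scale//.
    by rewrite EZ1 EZ0 EDF !mule0 !adde0.
  have bound (Y V : T -> R) (k : R) : 0 <= k -> measurable_fun [set: T] V ->
      P.-integrable [set: T] (EFin \o Y) -> (forall w, `|Y w| <= k * `|V w|) ->
      (`|\int[P]_w (Y w)%:E| <= k%:E * \int[P]_w `|V w|%:E)%E.
    move=> k0 mV /integrableP[mY _] YV; apply: (le_trans (le_abse_integral P measurableT mY)).
    rewrite -ge0_integralZl//; last first.
      by apply/measurable_EFinP; exact: measurableT_comp.
    apply: ge0_le_integral => //.
    - exact: measurableT_comp.
    - by apply: measurable_funeM; apply/measurable_EFinP; exact: measurableT_comp.
    - by move=> w _; rewrite -EFinM lee_fin; exact: YV.
  rewrite EU EUE -[leRHS]addeA (le_trans (lee_abs_add _ _))// leeD//.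
    by apply: (bound A E M1) => // w; rewrite /A normrM ler_wpM2r.
  rewrite (le_trans (lee_abs_add _ _))// [leLHS]addeC !abseM !abse_EFin normrN ger0_norm//.
  apply: leeD.
    by rewrite lee_wpmul2l// -[leRHS]mul1e; apply: (bound X X 1) => // w; rewrite mul1r.
  rewrite (muleC N%:E) -muleA lee_wpmul2l//.
  by apply: (bound B Rem N) => // w; rewrite /B normrM ler_wpM2r.
- rewrite -/c -/E Eoo gt0_muley ?lte_fin// -addeA addye ?leey//.
  rewrite gt_eqF// (lt_le_trans (ltNyr 0))// adde_ge0// mule_ge0//.
  - by rewrite integral_ge0.
  - by rewrite mule_ge0.
  - by rewrite integral_ge0.
Qed.

(** * Essential supremum norms on an interval *)

Lemma sup_norm_ae_le (R : realType) (J : set R) (g : R -> R) :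
  \forall x \ae (@lebesgue_measure R), J x -> (`|g x|%:E <= sup_norm J g)%E.
Proof.
have muT : (0 < @lebesgue_measure R setT)%E.
  apply: (@lt_le_trans _ _ (@lebesgue_measure R `]0, 1])).
    by rewrite lebesgue_measure_itv/= lte_fin ltr01 sube0 lte_fin.
  by apply: le_measure; rewrite ?inE.
rewrite /sup_norm unlock muT.
have aeF := ae_filter_ringOfSetsType (@lebesgue_measure R).
have := ess_sup_ge (@lebesgue_measure R) (abse \o (EFin \o (g \_ J))).
by apply: filterS => x /= + Jx; rewrite patchE mem_set.
Qed.

(** An interval of positive length is not contained in a null set. *)
Lemma ae_in_itv (R : realType) (Q : R -> Prop) (u v : R) : u < v ->
  (\forall x \ae (@lebesgue_measure R), Q x) -> exists2 z, u < z < v & Q z.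
Proof.
move=> uv [N [mN N0 QN]]; apply: contrapT => nQ.
have : (@lebesgue_measure R `]u, v[ <= lebesgue_measure N)%E.
  apply: le_measure; rewrite ?inE// => z; rewrite /= in_itv/= => uzv.
  by apply: QN => /= Qz; apply: nQ; exists z.
by rewrite N0 lebesgue_measure_itv/= lte_fin uv -EFinB lee_fin subr_le0 leNgt uv.
Qed.

Lemma abs_continuous_dist (R : realType) (J : set R) (g : R -> R) (e : R) :
  is_interval J -> abs_continuous_on J g -> 0 < e ->
  exists2 d, 0 < d & forall x y, J x -> J y -> `|x - y| < d -> `|g x - g y| < e.
Proof.
move=> iJ gac /gac[d d0 dP]; exists d => //.
suff le_case x y : J x -> J y -> x <= y -> `|x - y| < d -> `|g x - g y| < e.
  move=> x y Jx Jy; have [/le_case|/ltW/le_case] := leP x y; first exact.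
  by rewrite (distrC x) (distrC (g x)); apply.
move=> Jx Jy xy xyd.
have := dP 1%N (fun=> x) (fun=> y); rewrite !big_ord1 distrC; apply.
- move=> _; split => // z; rewrite /= in_itv/=; exact: iJ.
- by apply/trivIsetP => i j _ _; rewrite !ord1 eqxx.
- by rewrite -[ltLHS]ger0_norm ?subr_ge0// distrC.
Qed.

(** For a continuous function on a nondegenerate interval the essential
    supremum bounds every value, because every point of J is a limit of points
    where the bound holds. *)
Lemma abs_continuous_le_sup_norm (R : realType) (J : set R) (g : R -> R) (p q x : R) :
  is_interval J -> J p -> J q -> p < q -> abs_continuous_on J g -> J x ->
  (`|g x|%:E <= sup_norm J g)%E.
Proof.
move=> iJ Jp Jq pq gac Jx.
apply/lee_addgt0Pr => e e0.
have [d d0 dP] := abs_continuous_dist iJ gac e0.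
suff [z [Jz zx gz]] : exists z, [/\ J z, `|z - x| < d & (`|g z|%:E <= sup_norm J g)%E].
  apply: (@le_trans _ _ (`|g z|%:E + e%:E)%E); last exact: leeD2r.
  rewrite -EFinD lee_fin (_ : g x = g z - (g z - g x)); last by ring.
  by rewrite (le_trans (ler_normB _ _))// lerD2l ltW// dP.
have [xq|qx] := ltP x q.
- have [|z /andP[xz zm] /= gz] := ae_in_itv (u := x) (v := Num.min q (x + d)) _ (sup_norm_ae_le J g).
    by rewrite lt_min xq ltrDl.
  move: zm; rewrite lt_min => /andP[zq zd].
  have Jz : J z by apply: (iJ x q) => //; rewrite !ltW.
  by exists z; split; [|rewrite ger0_norm; lra|exact: gz].
- have px : p < x by exact: lt_le_trans qx.
  have [|z /andP[mz zx] /= gz] := ae_in_itv (u := Num.max p (x - d)) (v := x) _ (sup_norm_ae_le J g).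
    by rewrite gt_max px ltrBlDr ltrDl.
  move: mz; rewrite gt_max => /andP[pz dz].
  have Jz : J z by apply: (iJ p x) => //; rewrite !ltW.
  by exists z; split; [|rewrite ltr0_norm; lra|exact: gz].
Qed.

(** The essential bound on f' holds almost everywhere inside every segment of
    J, so [abs_continuous_le] applies to each of them. *)
Lemma abs_continuous_lipschitz (R : realType) (J : set R) (f f' : R -> R) (M : R) :
  is_interval J -> abs_continuous_on J f -> derivative_version J f f' ->
  sup_norm J f' = M%:E ->
  forall u v, J u -> J v -> `|f u - f v| <= M * `|u - v|.
Proof.
move=> iJ fac [_ df] f'M.
have M0 : 0 <= M by rewrite -lee_fin -f'M; exact: Lnorm_ge0.
suff le_case u v : J u -> J v -> u <= v -> `|f v - f u| <= M * (v - u).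
  move=> u v Ju Jv; have [uv|/ltW vu] := leP u v.
    by rewrite distrC (distrC u) (@ger0_norm _ (v - u)) ?subr_ge0//; exact: le_case.
  by rewrite (@ger0_norm _ (u - v)) ?subr_ge0//; exact: le_case.
move=> Ju Jv uv; have Juv : `[u, v] `<=` J.
  by move=> z; rewrite /= in_itv/=; exact: iJ.
apply: (abs_continuous_le (h' := f')) => //; first exact: abs_continuous_onS fac.
have aeF := ae_filter_ringOfSetsType (@lebesgue_measure R).
have := sup_norm_ae_le J f'; move: df; apply: filterS2 => x df f'x uxv.
have Jx : J° x.
  have /near_in_itvoo : x \in `]u, v[ by rewrite in_itv.
  by apply: filterS => w wuv; apply: Juv; exact: subset_itv_oo_cc wuv.
split; first exact: df.
by rewrite -lee_fin -f'M; apply: f'x; exact: interior_subset Jx.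
Qed.

(** * The two bounds *)

Lemma integral_onem_mul_id (R : realType) :
  (\int[lebesgue_measure]_(s in `[0%R, 1%R]) (((1 : R) - s) * s)%:E = (6^-1)%:E)%E.
Proof.
pose G (s : R) := s ^+ 2 / 2 - s ^+ 3 / 3.
have dG (s : R) : is_derive s (1 : R) G ((1 - s) * s).
  have h1 : is_derive s (1 : R) (@id R) 1 by exact: is_derive_id.
  have h2 := @is_deriveX _ _ (@id R) 2 s 1 _ h1.
  have h3 := @is_deriveX _ _ (@id R) 3 s 1 _ h1.
  have h4 := @is_deriveM _ _ _ _ s 1 _ _ h2 (is_derive_cst (2^-1 : R) s (1 : R)).
  have h5 := @is_deriveM _ _ _ _ s 1 _ _ h3 (is_derive_cst (3^-1 : R) s (1 : R)).
  apply: (is_derive_eq (@is_deriveB _ _ _ _ _ s 1 _ _ h4 h5)).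
  by rewrite /GRing.scale /= !mulr0 !add0r !mulr1; field.
have cG : continuous G.
  by move=> s; apply: differentiable_continuous; apply/derivable1_diffP; case: (dG s).
rewrite (@continuous_FTC2 _ (fun s => (1 - s) * s) G 0 1)//.
- by rewrite -EFinB /G; congr EFin; field.
- apply: continuous_subspaceT => s.
  by apply: cvgM; [apply: cvgB => //; exact: cvg_cst|exact: cvg_id].
- split.
  + by move=> s _; case: (dG s).
  + by apply: cvg_at_right_filter; exact: cG.
  + by apply: cvg_at_left_filter; exact: cG.
- by move=> s _; rewrite derive1E; case: (dG s).
Qed.

Lemma open_itv_two_points (R : realType) (a b : \bar R) : (a < b)%E ->
  exists p q : R, [/\ open_itv a b p, open_itv a b q & p < q].
Proof.
rewrite /open_itv /=; case: a b => [r| |] [s| |] //=; rewrite ?lte_fin => rs.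
- exists ((r + r + s) / 3), ((r + s + s) / 3); rewrite !lte_fin; split; [split|split|]; lra.
- by exists (r + 1), (r + 2); rewrite !lte_fin !ltry; split; [split|split|] => //; lra.
- by exists (s - 2), (s - 1); rewrite !lte_fin !ltNyr; split; [split|split|] => //; lra.
- by exists 0, 1; rewrite !ltry !ltNyr.
Qed.

Theorem proposition2p31
  (R : realType)
  (a b : \bar R) (hab : (a < b)%E)
  (mu : probability (measurableTypeR R) R) (p : R -> R)
  (p_meas : measurable_fun [set: R] p)
  (p_ge0 : forall x, 0 <= p x)
  (mu_density : forall A : set R, measurable A ->
     mu A = (\int[lebesgue_measure]_(x in A) (p x)%:E)%E)
  (mu_support : mu (~` closure (open_itv a b)) = 0%E)
  (p_gt0 : forall x, open_itv a b x -> 0 < p x)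
  (p_ac : forall c d : R, c <= d -> `[c, d] `<=` open_itv a b -> abs_continuous_on `[c, d] p)
  (gamma eta : R -> R)
  (gamma_cont : {within closure (open_itv a b), continuous gamma})
  (gamma_decr : forall x y : R, closure (open_itv a b) x -> closure (open_itv a b) y -> x < y ->
     gamma y < gamma x)
  (gamma_int : (\int[lebesgue_measure]_(t in open_itv a b) (`|gamma t| * p t)%:E < +oo)%E)
  (gamma_int0 : (\int[lebesgue_measure]_(t in open_itv a b) (gamma t * p t)%:E = 0)%E)
  (gamma_zero : exists! x0 : R, closure (open_itv a b) x0 /\ gamma x0 = 0)
  (eta_def : forall x, open_itv a b x ->
     eta x = (p x)^-1 *
       \int[lebesgue_measure]_(t in [set t : R | (a < t%:E)%E /\ t <= x])
         (gamma t * p t))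
  (J : set R) (J_itv : is_interval J) (IJ : open_itv a b `<=` J)
  (d : measure_display) (T : measurableType d) (P : probability T R)
  (W W' : {RV P >-> R})
  (W_W'_id : forall A : set R, measurable A ->
     distribution P W A = distribution P W' A)
  (WJ : forall w, J (W w)) (W'J : forall w, J (W' w))
  (gammaW_meas : measurable_fun [set: T] (fun w => gamma (W w)))
  (etaW_meas : measurable_fun [set: T] (fun w => eta (W w)))
  (W_L2 : (W : T -> R) \in Lfun P 2%:E)
  (gammaW_int : ('E_P[fun w => `|gamma (W w)|%R] < +oo)%E)
  (* CE1 = E[W' - W | W] and CE2 = E[(W' - W)^2 | W] *)
  (CE1 CE2 : T -> R)
  (CE1_def : cond_expectation_version P W (fun w => W' w - W w) CE1)
  (CE2_def : cond_expectation_version P W (fun w => (W' w - W w) ^+ 2) CE2)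
  (lambda : R) (lambda_gt0 : 0 < lambda) (Rem : {RV P >-> R})
  (regression : \forall w \ae P, CE1 w = lambda * gamma (W w) + Rem w)
  (f f' : R -> R)
  (f_ac : abs_continuous_on J f)
  (f'_def : derivative_version J f f')
  (f_bnd : (sup_norm J f < +oo)%E)
  (f'_bnd : (sup_norm J f' < +oo)%E) :
  (* The Borel version f' is arbitrary on Lebesgue-null sets, which W may
     charge; the first bound needs the version to obey |f'| <= ||f'||_oo
     along W.  Otherwise it fails: take mu = N(0, 1), gamma x = - x, eta = 1,
     W = W' = 0, Rem = 0, f = 0 and f' the indicator of {0}. *)
  ((\forall w \ae P, (`|f' (W w)|%:E <= sup_norm J f')%E) ->
   (`| 'E_P[fun w => (eta (W w) * f' (W w) + gamma (W w) * f (W w))%R] | <=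
      sup_norm J f' * 'E_P[fun w => `|eta (W w) - (2 * lambda)^-1 * CE2 w|%R]
      + (lambda^-1)%R%:E *
        \int[P]_w (((W' w - W w) ^+ 2)%R%:E *
          \int[lebesgue_measure]_(s in `[0%R, 1%R])
            ((1 - s) * `|f' (W w) - f' (W w + s * (W' w - W w))|)%R%:E)
      + sup_norm J f * (lambda^-1)%R%:E * 'E_P[fun w => `|Rem w|%R])%E) /\
  (abs_continuous_on J f' ->
   forall f'' : R -> R, derivative_version J f' f'' ->
   (sup_norm J f'' < +oo)%E ->
   (`| 'E_P[fun w => (eta (W w) * f' (W w) + gamma (W w) * f (W w))%R] | <=
      sup_norm J f' * 'E_P[fun w => `|eta (W w) - (2 * lambda)^-1 * CE2 w|%R]
      + sup_norm J f'' * ((6 * lambda)^-1)%R%:E *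
        'E_P[fun w => (`|W' w - W w| ^+ 3)%R]
      + sup_norm J f * (lambda^-1)%R%:E * 'E_P[fun w => `|Rem w|%R])%E).
Proof.
have mJ : measurable J by exact: is_interval_measurable.
have [x1 [x2 [/IJ Jx1 /IJ Jx2 x12]]] := open_itv_two_points hab.
have EE (X : T -> R) : ('E_P[X] = \int[P]_w (X w)%:E)%E by rewrite unlock.
have [M M0 f'M] : exists2 M, 0 <= M & sup_norm J f' = M%:E.
  exists (fine (sup_norm J f')); first by rewrite fine_ge0// Lnorm_ge0.
  by rewrite fineK// ge0_fin_numE// Lnorm_ge0.
have [N N0 fNE] : exists2 N, 0 <= N & sup_norm J f = N%:E.
  exists (fine (sup_norm J f)); first by rewrite fine_ge0// Lnorm_ge0.
  by rewrite fineK// ge0_fin_numE// Lnorm_ge0.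
have fL := abs_continuous_lipschitz J_itv f_ac f'_def f'M.
have fN x : J x -> `|f x| <= N.
  move=> Jx; rewrite -lee_fin -fNE.
  exact: (abs_continuous_le_sup_norm J_itv Jx1 Jx2 x12 f_ac Jx).
have [F FN dF] := lipschitz_primitive mJ N0 fL fN.
have mf : measurable_fun J f := lipschitz_measurable mJ fL.
have [mf' _] := f'_def.
have mW : measurable_fun [set: T] W by exact: measurable_funPT.
have mW' : measurable_fun [set: T] W' by exact: measurable_funPT.
have mcompW (h : R -> R) : measurable_fun J h -> measurable_fun [set: T] (fun w => h (W w)).
  by move=> mh; apply: (measurable_comp mJ _ mh mW) => _ [w _ <-]; exact: WJ.
(* f' is cut off where it exceeds its essential supremum, so that f' \_ A is
   bounded everywhere while still equal to f' along W almost surely *)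
pose A : set R := J `&` [set x | `|f' x| <= M].
have mA : measurable A.
  have mnf' : measurable_fun J (fun x => `|f' x|) by exact: measurableT_comp.
  have := mnf' mJ _ (measurable_itv `]-oo, M]).
  by rewrite (_ : _ @^-1` _ = [set x | `|f' x| <= M])//; apply/seteqP; split => x /=; rewrite in_itv.
have mphi0 : measurable_fun [set: R] (f \_ J) by apply/(measurable_restrictT _ mJ).
have mphi1 : measurable_fun [set: R] (f' \_ A).
  apply/(measurable_restrictT _ mA); apply: (@measurable_funS _ _ _ _ J) => //.
  exact: subIsetl.
have phi0N x : `|(f \_ J) x| <= N.
  by rewrite patchE; case: ifPn => [/set_mem/fN//|_]; rewrite normr0.
have phi1M x : `|(f' \_ A) x| <= M.
  by rewrite patchE; case: ifPn => [/set_mem[]//|_]; rewrite normr0.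
have iW2 : P.-integrable [set: T] (EFin \o (fun w => W w ^+ 2)) := Lfun2_integrable_sqr W_L2.
have igW : P.-integrable [set: T] (EFin \o (fun w => gamma (W w))).
  by apply/integrableP; split; [exact/measurable_EFinP|move: gammaW_int; rewrite EE].
have phi0W w : (f \_ J) (W w) = f (W w) by rewrite patchE mem_set.
pose Taylor w := F (W' w) - F (W w) - f (W w) * (W' w - W w)
  - (W' w - W w) ^+ 2 / 2 * f' (W w).
have mTaylor (u v : T -> R) : measurable_fun [set: T] u -> measurable_fun [set: T] v ->
    measurable_fun [set: T] (fun w => `|F (W' w) - F (W w) - u w * (W' w - W w)
      - (W' w - W w) ^+ 2 / 2 * v w|%:E).
  move=> mu' mv; apply/measurable_EFinP; apply: measurableT_comp => //.
  have mF : measurable_fun [set: R] F.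
    by apply: (lipschitz_measurable (L := N)) => // x y _ _; exact: FN.
  have mD : measurable_fun [set: T] (fun w => W' w - W w) by exact: measurable_funB.
  apply: measurable_funB; last first.
    by apply: measurable_funM => //; apply: measurable_funM => //; exact: measurable_funX.
  apply: measurable_funB; last exact: measurable_funM.
  by apply: measurable_funB; exact: measurableT_comp.
have mStein (u v : T -> R) : measurable_fun [set: T] u -> measurable_fun [set: T] v ->
    measurable_fun [set: T] (fun w => (eta (W w) * v w + gamma (W w) * u w)%:E).
  by move=> mu' mv; apply/measurable_EFinP; apply: measurable_funD; exact: measurable_funM.
have mf'W := mcompW _ mf'; have mfW := mcompW _ mf.
have mphi1W : measurable_fun [set: T] (fun w => (f' \_ A) (W w)) by exact: measurableT_comp.
have mphi0W : measurable_fun [set: T] (fun w => (f \_ J) (W w)) by exact: measurableT_comp.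
(* both inequalities estimate the Taylor remainder in this bound *)
have main : (\forall w \ae P, (`|f' (W w)|%:E <= sup_norm J f')%E) ->
    (`| 'E_P[fun w => (eta (W w) * f' (W w) + gamma (W w) * f (W w))%R] | <=
      M%:E * 'E_P[fun w => `|eta (W w) - (2 * lambda)^-1 * CE2 w|%R]
      + (lambda^-1)%R%:E * \int[P]_w `|Taylor w|%:E
      + N%:E * (lambda^-1)%R%:E * 'E_P[fun w => `|Rem w|%R])%E.
  move=> f'W; rewrite !EE.
  have aeF := ae_filter_ringOfSetsType P.
  have phi1W : \forall w \ae P, (f' \_ A) (W w) = f' (W w).
    move: f'W; apply: filterS => w; rewrite f'M lee_fin => f'Wle.
    by rewrite patchE mem_set.
  have := identically_distributed_pair_bound W_W'_id iW2 gammaW_meas etaW_meas igW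
    CE1_def CE2_def lambda_gt0 regression FN mphi0 mphi1 phi0N phi1M.
  under eq_integral do rewrite phi0W.
  rewrite (@ae_eq_integral _ _ _ P setT
     (fun w => (eta (W w) * f' (W w) + gamma (W w) * f (W w))%:E))//.
  - move/le_trans; apply; apply: leeD2r; apply: leeD2l.
    rewrite lee_wpmul2l ?lee_fin ?invr_ge0 ?(ltW lambda_gt0)//.
    rewrite le_eqVlt; apply/orP; left; apply/eqP.
    apply: ae_eq_integral => //.
    + exact: mTaylor.
    + exact: mTaylor.
    + move: phi1W; apply: filterS => w phi1W _.
      by rewrite phi0W phi1W.
  - exact: mStein.
  - exact: mStein.
  - by move: phi1W; apply: filterS => w -> _.
have taylor w := taylor2_le J_itv fL fN f'_def FN dF M0 (WJ w) (W'J w).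
split.
- move=> f'W; apply: (le_trans (main f'W)).
  rewrite f'M fNE; apply: leeD2r; apply: leeD2l.
  rewrite lee_wpmul2l ?lee_fin ?invr_ge0 ?(ltW lambda_gt0)//.
  by apply: ge0_le_integral_nomeas => w _; [rewrite lee_fin|exact: taylor].
- move=> f'_ac f'' f''_def f''_bnd.
  have f'J x : J x -> (`|f' x|%:E <= sup_norm J f')%E.
    exact: (abs_continuous_le_sup_norm J_itv Jx1 Jx2 x12 f'_ac).
  have [M2 M20 f''M] : exists2 M, 0 <= M & sup_norm J f'' = M%:E.
    exists (fine (sup_norm J f'')); first by rewrite fine_ge0// Lnorm_ge0.
    by rewrite fineK// ge0_fin_numE// Lnorm_ge0.
  have f'L := abs_continuous_lipschitz J_itv f'_ac f''_def f''M.
  apply: (le_trans (main _)); first by apply: aeW => w; exact: f'J.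
  rewrite f'M fNE f''M; apply: leeD2r; apply: leeD2l.
  rewrite EE.
  (* f' is M2-Lipschitz, and the integral of (1 - s) s over [0, 1] is 1 / 6 *)
  have T3 w : (`|Taylor w|%:E <= (M2 / 6 * `|W' w - W w| ^+ 3)%:E)%E.
    apply: (le_trans (taylor w)).
    have -> : ((M2 / 6 * `|W' w - W w| ^+ 3)%:E =
        ((W' w - W w) ^+ 2)%:E * ((M2 * `|W' w - W w|)%:E * (6^-1)%:E))%E.
      rewrite -!EFinM; congr EFin.
      by rewrite -(real_normK (num_real (W' w - W w))); field.
    apply: lee_wpmul2l; first by rewrite lee_fin sqr_ge0.
    rewrite -integral_onem_mul_id -ge0_integralZl//; last 3 first.
    - apply/measurable_EFinP; apply: measurable_funM => //; exact: measurable_funB.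
    - move=> s; rewrite /= in_itv/= => /andP[s0 s1].
      by rewrite lee_fin mulr_ge0// subr_ge0.
    - by rewrite lee_fin mulr_ge0.
    apply: ge0_le_integral_nomeas => s; rewrite /= in_itv/= => s01.
      by case/andP: s01 => s0 s1; rewrite lee_fin mulr_ge0// subr_ge0.
    have Js := segment_subset J_itv (WJ w) (W'J w) s01.
    have := f'L _ _ (WJ w) Js; case/andP: s01 => s0 s1.
    rewrite opprD addrA subrr add0r normrN normrM (ger0_norm s0) => f's.
    rewrite -EFinM lee_fin [leRHS]mulrCA ler_wpM2l ?subr_ge0//.
    by rewrite (le_trans f's)// le_eqVlt; apply/orP; left; apply/eqP; ring.
  apply: (@le_trans _ _ ((lambda^-1)%:E * \int[P]_w (M2 / 6 * `|W' w - W w| ^+ 3)%:E)%E).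
    rewrite lee_wpmul2l ?lee_fin ?invr_ge0 ?(ltW lambda_gt0)//.
    by apply: ge0_le_integral_nomeas => w _; [rewrite lee_fin|exact: T3].
  under eq_integral do rewrite EFinM.
  rewrite ge0_integralZl//; last 2 first.
  - apply/measurable_EFinP; apply: measurable_funX; apply: measurableT_comp => //.
    exact: measurable_funB.
  - by rewrite lee_fin divr_ge0.
  rewrite muleA -!EFinM le_eqVlt; apply/orP; left; apply/eqP; congr (_%:E * _)%E.
  by field; rewrite gt_eqF.
Qed.
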